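(* Let $p$ be a prime, let $k$ be a positive integer, and let $n\geq 2$ be an integer coprime with $p$. Put $N=n^{p^k}-1$ and consider the linear Alexander quandle on $\mathbf{Z}/N\mathbf{Z}$ with parameter $n$, i.e. $a\ast b = na+(1-n)b \pmod N$. Then: (i) for every $b\in\mathbf{Z}/N\mathbf{Z}$, the right translation $R_b:x\mapsto x\ast b$ decomposes into disjoint cycles consisting of exactly $n-1$ cycles of length $1$ and, for each $1\le i\le k$, exactly $\dfrac{n^{p^i}-n^{p^{i-1}}}{p^i}$ cycles of length $p^i$, and no cycles of any other length; in particular the profile of this quandle is the single pattern $$\{ \underbrace{1,\dots,1}_{n-1}, \underbrace{p,\dots,p}_{(n^p-n)/p}, \dots, \underbrace{p^i,\dots,p^i}_{(n^{p^i}-n^{p^{i-1}})/p^i}, \dots, \underbrace{p^k,\dots,p^k}_{(n^{p^k}-n^{p^{k-1}})/p^k} \};$$ (ii) this quandle is not connected.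
   Context: A quandle is a set $X$ with a binary operation $\ast$ such that for all $a,b,c\in X$: $a\ast a=a$; there is a unique $x\in X$ with $x\ast b=a$; and $(a\ast b)\ast c=(a\ast c)\ast(b\ast c)$. For $m$ invertible modulo $N$, the linear Alexander quandle of order $N$ and parameter $m$ is $\mathbf{Z}/N\mathbf{Z}$ with $a\ast b=ma+(1-m)b \pmod N$. The right translation $R_y$ is the permutation $x\mapsto x\ast y$. The pattern of a permutation is the list of lengths of its disjoint cycles; the profile of a quandle is the list of patterns of its right translations, and when all right translations have the same pattern the profile is identified with that pattern. A quandle $(X,\ast)$ is connected if for any $i,j\in X$ there are finitely many $k_1,\dots,k_l\in X$ with $j=(\cdots((i\ast k_1)\ast k_2)\ast\cdots)\ast k_l$.
   Formalization: Part (ii), that the quandle is not connected, is stated only for n ≥ 3: for n = 2 it is false, since then a∗b = 2a − b and i∗(2i − j) = j for all i, j, so the quandle is connected (e.g. p = 3, k = 1, N = 7). *)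

(* Defs.v *)
From HB Require Import structures.
From mathcomp Require Import all_boot all_order all_fingroup all_algebra ring.

Set Implicit Arguments.
Unset Strict Implicit.
Unset Printing Implicit Defensive.

Import GRing.Theory.
Local Open Scope ring_scope.

HB.mixin Record isQuandle X := {
  qop : X -> X -> X;
  qop_idem : forall a, qop a a = a;
  qop_div : forall a b, exists! x, qop x b = a;
  qop_dist : forall a b c, qop (qop a b) c = qop (qop a c) (qop b c)
}.

#[short(type="quandleType")]
HB.structure Definition Quandle := {X of isQuandle X}.

#[short(type="finQuandleType")]
HB.structure Definition FinQuandle := {X of isQuandle X & Finite X}.

Definition connected (X : quandleType) : Prop :=
  forall i j : X, exists ks : seq X, j = foldl qop i ks.

Lemma qop_inj (X : quandleType) (b : X) : injective (fun x : X => qop x b).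
Proof.
by move=> x y exy; have [z [_ uz]] := qop_div (qop y b) b; rewrite -(uz x) // -(uz y).
Qed.

Definition rtrans (X : finQuandleType) (b : X) : {perm X} := perm (@qop_inj X b).

(* Patterns are lists up to order; they are normalized to be nondecreasing. *)
Definition pattern (T : finType) (s : {perm T}) : seq nat :=
  sort leq [seq #|C| | C : {set T} in porbits s].

Definition ncycles (T : finType) (s : {perm T}) (l : nat) : nat :=
  #|[set C in porbits s | #|C| == l]|.

Definition profile (X : finQuandleType) : seq (seq nat) :=
  [seq pattern (rtrans b) | b : X].

(* 'Z_N is Z/NZ only for 1 < N. *)
Definition alexander (N : nat) (m : 'Z_N) (hm : m \is a GRing.unit) : Type := 'Z_N.

Section Alexander.
Variables (N : nat) (m : 'Z_N) (hm : m \is a GRing.unit).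

Definition alexander_op (a b : 'Z_N) : 'Z_N := m * a + (1 - m) * b.

Fact alexander_idem a : alexander_op a a = a.
Proof. by rewrite /alexander_op; ring. Qed.

Fact alexander_div a b : exists! x, alexander_op x b = a.
Proof.
exists (m^-1 * (a - (1 - m) * b)); split; rewrite /alexander_op.
  by rewrite mulVKr // subrK.
by move=> x <-; rewrite addrK mulKr.
Qed.

Fact alexander_dist a b c :
  alexander_op (alexander_op a b) c = alexander_op (alexander_op a c) (alexander_op b c).
Proof. by rewrite /alexander_op; ring. Qed.

HB.instance Definition _ := Finite.on (alexander hm).
HB.instance Definition _ :=
  isQuandle.Build (alexander hm) alexander_idem alexander_div alexander_dist.

End Alexander.

Lemma natr_unit_pred_exp (p k n : nat) :
  prime p -> (0 < k)%N -> (1 < n)%N -> (n%:R : 'Z_(n ^ (p ^ k) - 1)) \is a GRing.unit.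
Proof.
move=> pp k0 n1.
have pk1 : (1 < p ^ k)%N by rewrite -(exp1n k) ltn_exp2r // prime_gt1.
have e4 : (2 ^ 2 <= n ^ (p ^ k))%N.
  by apply: (@leq_trans (n ^ 2)); [rewrite leq_exp2r | rewrite leq_exp2l].
have N1 : (1 < n ^ (p ^ k) - 1)%N by rewrite ltn_subRL; apply: leq_trans e4.
rewrite unitZpE // subn1 coprime_sym -(prednK (ltnW pk1)) expnS.
have := coprimenP (n := n * n ^ (p ^ k).-1).
rewrite muln_gt0 expn_gt0 (ltnW n1) /= => /(_ isT).
by rewrite coprimeMl => /andP[].
Qed.

(* Main.v *)
(* A right translation satisfies R_b^j x - b = n^j (x - b), so R_b^j fixes exactly
   n^j - 1 points whenever n^j - 1 divides N. Taking j = p^i, the points on cycles of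
   length exactly p^i are those fixed by R_b^(p^i) but not by R_b^(p^(i-1)), and
   there are n^(p^i) - n^(p^(i-1)) of them. Since x * y - x is a multiple of 1 - n,
   connectedness would make 1 - n invertible modulo its multiple N. *)
Require Import Defs.
From HB Require Import structures.
From mathcomp Require Import all_boot all_order all_fingroup all_algebra.
From mathcomp Require Import ring.

(** The iterates of [s] at [x] repeat with period [o], so [m] may be replaced by [m %% o]. The first
    [o] iterates are distinct, so that remainder fixes [x] only when it is zero. *)
Lemma porbit_dvdn (T : finType) (s : {perm T}) (x : T) (m : nat) :
  (#|porbit s x| %| m) = ((s ^+ m)%g x == x).
Proof.
set o := #|porbit s x|.
have o0 : 0 < o by rewrite lt0n card_porbit_neq0.
have iter_o q : iter (q * o) s x = x.
  by elim: q => [|q IHq] //; rewrite mulSn iterD IHq iter_porbit.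
rewrite permX {2}(divn_eq m o) addnC iterD iter_o /dvdn.
have r0 : m %% o < o by rewrite ltn_mod.
have := nth_uniq x _ _ (uniq_traject_porbit s x); rewrite size_traject.
by move=> /(_ _ _ r0 o0); rewrite !nth_traject // => ->.
Qed.

Lemma card_porbit_eq (T : finType) (s : {perm T}) (l : nat) :
  #|[set x | #|porbit s x| == l]| = ncycles s l * l.
Proof.
rewrite -sum1_card (partition_big (porbit s) (fun C => C \in [set C in porbits s | #|C| == l])).
  rewrite -sum_nat_const; apply: eq_bigr => C; rewrite inE => /andP[/imsetP[y _ ->] /eqP yl].
  rewrite -[in RHS]yl -sum1_card; apply: eq_bigl => x; rewrite inE eq_porbit_mem.
  by case: (boolP (x \in porbit s y)); rewrite ?andbF // -eq_porbit_mem => /eqP ->; rewrite yl eqxx.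
by move=> x; rewrite !inE => ->; rewrite andbT imset_f.
Qed.

(** A divisor of [p ^ i.+1] that does not divide [p ^ i] is [p ^ i.+1] itself, so the difference of
    the two fixed-point sets consists of the points on cycles of that length. *)
Lemma ncycles_prime_exp (T : finType) (s : {perm T}) (p i : nat) : prime p ->
  ncycles s (p ^ i.+1) * p ^ i.+1 =
    #|[set x | (s ^+ (p ^ i.+1))%g x == x]| - #|[set x | (s ^+ (p ^ i))%g x == x]|.
Proof.
move=> pp; rewrite -card_porbit_eq -cardsDS; last first.
  by apply/subsetP=> x; rewrite !inE -!porbit_dvdn => /dvdn_trans-> //; rewrite dvdn_exp2l.
apply: eq_card => x; rewrite !inE -!porbit_dvdn.
apply/eqP/andP => [->|[]].
  by rewrite dvdnn dvdn_Pexp2l ?prime_gt1 // ltnn.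
case/boolP: (_ %| p ^ i) => // nd _ /(dvdn_pfactor _ _ pp)[j ji e].
move: nd; rewrite e dvdn_Pexp2l ?prime_gt1 // -ltnNge => ij.
by congr (_ ^ _); apply/eqP; rewrite eqn_leq ji.
Qed.

Lemma sorted_flatten_nseq (c : nat -> nat) (r : seq nat) :
  sorted leq r -> sorted leq (flatten [seq nseq (c l) l | l <- r]).
Proof.
rewrite !sorted_pairwise; try exact: leq_trans.
elim: r => //= l r IHr /andP[/allP lr /IHr sr]; rewrite pairwise_cat sr andbT.
apply/andP; split.
  apply/allrelP => x y /nseqP[-> _] /flatten_mapP[m mr /nseqP[-> _]].
  exact: lr.
by elim: (c l) => //= a ->; rewrite andbT; apply/allP => x /nseqP[->].
Qed.

Lemma count_flatten_nseq (c : nat -> nat) (r : seq nat) (m : nat) : uniq r ->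
  count_mem m (flatten [seq nseq (c l) l | l <- r]) = (m \in r) * c m.
Proof.
elim: r => //= l r IHr /andP[lr /IHr {}IHr].
rewrite count_cat count_nseq IHr in_cons /= eq_sym; case: eqVneq => [e|_] //=.
by rewrite e (negbTE lr) addn0.
Qed.

(** Both sides are nondecreasing, so it suffices to compare multiplicities. As [r] has no
    repetition, each length fills one block; a length outside [r] occurs on neither side. *)
Lemma pattern_ncycles (T : finType) (s : {perm T}) (r : seq nat) : sorted ltn r ->
  {in porbits s, forall C : {set T}, #|C| \in r} ->
  pattern s = flatten [seq nseq (ncycles s l) l | l <- r].
Proof.
rewrite ltn_sorted_uniq_leq => /andP[ur sr] Hr.
apply: (sorted_eq leq_trans anti_leq); first by apply: sort_sorted; exact: leq_total.
  exact: sorted_flatten_nseq.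
rewrite perm_sort /perm_eq; apply/allP => m _ /=.
rewrite count_flatten_nseq // count_map.
have -> : count (preim (fun C : {set T} => #|C|) (pred1 m)) (enum (porbits s)) = ncycles s m.
  rewrite /ncycles cardE -size_filter; apply: perm_size; apply: uniq_perm.
  - apply: filter_uniq. exact: enum_uniq.
  - exact: enum_uniq.
  - by move=> C; rewrite mem_filter !mem_enum [in RHS]inE andbC.
case: (boolP (m \in r)) => [_|nm]; first by rewrite mul1n.
apply/eqP; rewrite mul0n; apply: eq_card0 => C; rewrite !inE.
by apply/negP => /andP[/Hr Cr /eqP mC]; rewrite -mC Cr in nm.
Qed.

Import GRing.Theory.

(** With [N = e * d], the solutions are the multiples [i * e] for [i < d]. *)
Lemma card_annihilator_Zp (N d : nat) : 1 < N -> d %| N ->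
  #|[set x : 'Z_N | (d%:R * x == 0)%R]| = d.
Proof.
move=> N1 /dvdnP[e Ne].
have [e0 d0] : 0 < e /\ 0 < d by apply/andP; rewrite -muln_gt0 -Ne ltnW.
pose f (i : 'I_d) : 'Z_N := ((i * e)%:R)%R.
have vf i : f i = i * e :> nat.
  by rewrite val_Zp_nat // modn_small // Ne mulnC ltn_pmul2l.
have fI : injective f.
  move=> i j /(congr1 val) /=; rewrite !vf => /eqP; rewrite eqn_pmul2r // => /eqP ij.
  exact: val_inj.
rewrite -[RHS]card_ord -(card_imset _ fI); apply: eq_card => x; rewrite !inE.
rewrite -(natr_Zp x) -natrM -(inj_eq val_inj) /= val_Zp_nat //.
rewrite -/(N %| _) natr_Zp.
apply/idP/imsetP => [|[i _ ->]]; last first.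
  by rewrite vf mulnCA (mulnC d) -Ne dvdn_mull.
move=> Nx; have /dvdnP[q xq] : e %| x by rewrite -(dvdn_pmul2l d0) (mulnC d e) -Ne.
have qd : q < d.
  by rewrite -(ltn_pmul2r e0) -xq (mulnC d) -Ne -[X in _ < X](Zp_cast N1).
by exists (Ordinal qd) => //; apply: val_inj; rewrite /= xq -(vf (Ordinal qd)).
Qed.

Lemma rtrans_alexanderX (N : nat) (m : 'Z_N) (hm : m \is a GRing.unit)
    (b x : alexander hm) (j : nat) :
  (rtrans b ^+ j)%g x = (m ^+ j * ((x : 'Z_N) - b) + b)%R :> 'Z_N.
Proof.
rewrite permX; elim: j => [|j IHj] /=; first by rewrite expr0 mul1r subrK.
by rewrite permE /= /qop /= /alexander_op IHj exprS; ring.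
Qed.

(** The class modulo [1 - m] is invariant under right translations. *)
Lemma foldl_alexander (N : nat) (m : 'Z_N) (hm : m \is a GRing.unit)
    (a : alexander hm) (ks : seq (alexander hm)) :
  exists z : 'Z_N, foldl qop a ks = ((a : 'Z_N) + (1 - m) * z)%R :> 'Z_N.
Proof.
elim: ks a => [|y ks IHks] a /=; first by exists 0%R; rewrite mulr0 addr0.
(* The first step contributes [y - a], since [m * a + (1 - m) * y = a + (1 - m) * (y - a)]. *)
have [z ->] := IHks (qop a y); exists (z + (y : 'Z_N) - a)%R.
by rewrite /qop /= /alexander_op; ring.
Qed.

(** A path from 0 to 1 exhibits 1 as a multiple of [1 - m]. *)
Lemma connected_alexander_unit (N : nat) (m : 'Z_N) (hm : m \is a GRing.unit) :
  connected (alexander hm) -> (1 - m)%R \is a GRing.unit.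
Proof.
move=> /(_ (0 : 'Z_N)%R (1 : 'Z_N)%R) [ks]; have [z ->] := foldl_alexander _ _ hm (0 : 'Z_N)%R ks.
rewrite add0r => e; apply/unitrP; exists z; split; rewrite // mulrC.
by rewrite -e.
Qed.

Lemma dvdn_expn_sub1 (n a b : nat) : a %| b -> n ^ a - 1 %| n ^ b - 1.
Proof.
move=> /dvdnP[q ->]; rewrite mulnC expnM -[X in _ %| _ - X](exp1n q) subn_exp.
exact: dvdn_mulr.
Qed.

Lemma card_fix_alexander (N n : nat) (hm : (n%:R : 'Z_N)%R \is a GRing.unit)
    (b : alexander hm) (j : nat) : 1 < N -> 0 < n -> n ^ j - 1 %| N ->
  #|[set x | (rtrans b ^+ j)%g x == x]| = n ^ j - 1.
Proof.
move=> N1 n0 dN; rewrite -[RHS](card_annihilator_Zp N _ N1 dN).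
(* Translation by [b] carries the annihilator of [n ^ j - 1] onto the fixed points. *)
pose f (x : 'Z_N) : 'Z_N := (x + (b : 'Z_N))%R.
have fI : injective f by exact: addIr.
rewrite -(card_imset _ fI); apply: eq_card => x; rewrite inE.
transitivity ((n ^ j - 1)%:R * ((x : 'Z_N) - b) == 0 :> 'Z_N)%R.
  rewrite -[LHS]/(((rtrans b ^+ j)%g x : 'Z_N) == x) rtrans_alexanderX.
  rewrite natrB ?expn_gt0 ?n0 // natrX -subr_eq0; congr (_ == _)%R; ring.
apply/idP/imsetP => [h|[y]]; last by rewrite inE => h ->; rewrite /f addrK.
by exists ((x : 'Z_N) - b)%R; rewrite ?inE // /f subrK.
Qed.

Theorem theorem3p3 (p k n : nat) (hp : prime p) (hk : 0 < k) (hn : 1 < n)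
    (hnp : coprime n p) :
  let N := n ^ (p ^ k) - 1 in
  let Q : finQuandleType := alexander (natr_unit_pred_exp hp hk hn) in
  let mult i := (n ^ (p ^ i) - n ^ (p ^ i.-1)) %/ p ^ i in
  [/\ forall b : Q,
        [/\ ncycles (rtrans b) 1 = n - 1,
            forall i, 1 <= i <= k ->
              p ^ i %| n ^ (p ^ i) - n ^ (p ^ i.-1)
              /\ ncycles (rtrans b) (p ^ i) = mult i
          & forall C, C \in porbits (rtrans b) ->
              #|C| = 1 \/ exists i, 1 <= i <= k /\ #|C| = p ^ i],
      profile Q =
        nseq N (nseq (n - 1) 1 ++ flatten [seq nseq (mult i) (p ^ i) | i <- iota 1 k])
  (* for n = 2 the quandle is connected, since 1 - n = -1 is a unit *)
    & 2 < n -> ~ connected Q].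
Proof.
move=> N Q mult.
have n0 : 0 < n by apply: ltnW.
have p1 : 1 < p by apply: prime_gt1.
have nN : n < N.
  have pk1 : 1 < p ^ k by rewrite -(exp1n k) ltn_exp2r.
  rewrite ltn_subRL add1n; apply: (@leq_trans (n ^ 2)); last by rewrite leq_exp2l.
  by rewrite -mulnn -addn2 (leq_trans (n := n + n)) ?leq_add2l // addnn -muln2 leq_mul.
have N1 : 1 < N by apply: ltn_trans nN.
(* ['Z_N] is an ordinal type whose size is [N] only because [1 < N]. *)
have cardQ : #|Q| = N by rewrite card_ord [_.+2]Zp_cast.
have fix_p (b : Q) i : i <= k ->
    #|[set x | (rtrans b ^+ (p ^ i))%g x == x]| = n ^ (p ^ i) - 1.
  by move=> ik; rewrite card_fix_alexander // dvdn_expn_sub1 // dvdn_exp2l.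
have nc1 (b : Q) : ncycles (rtrans b) 1 = n - 1.
  rewrite -[LHS]muln1 -card_porbit_eq -[in RHS](expn1 n) -(expn0 p) -(fix_p b 0) //.
  by apply: eq_card => x; rewrite !inE -porbit_dvdn dvdn1.
have ncp (b : Q) i : 0 < i <= k ->
    ncycles (rtrans b) (p ^ i) * p ^ i = n ^ (p ^ i) - n ^ (p ^ i.-1).
  case: i => // i ik; rewrite ncycles_prime_exp // !fix_p //; last exact: ltnW.
  (* Subtraction is truncated, so cancelling the two ones requires the powers of [n] to be
     positive. *)
  by rewrite subnBA ?expn_gt0 ?n0 // subnK // expn_gt0 n0.
have ncm (b : Q) i : 0 < i <= k -> ncycles (rtrans b) (p ^ i) = mult i.
  by move=> ik; rewrite /mult -(ncp b) // mulnK // expn_gt0 ltnW.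
have lenC (b : Q) C : C \in porbits (rtrans b) -> exists2 i, i <= k & #|C| = p ^ i.
  case/imsetP=> x _ ->; apply/(dvdn_pfactor _ _ hp); rewrite porbit_dvdn.
  (* Since [n ^ (p ^ k) - 1] is [N], the power [p ^ k] of the translation fixes every point, and all
     cycle lengths divide [p ^ k]. *)
  have /setP/(_ x) : [set x | (rtrans b ^+ (p ^ k))%g x == x] = setT.
    by apply/eqP; rewrite eqEcard subsetT cardsT cardQ fix_p /=.
  by rewrite !inE => ->.
split.
- move=> b; split=> //.
  + by move=> i ik; rewrite -(ncp b) // dvdn_mull // ncm.
  + move=> C /lenC[[|i] ik ->]; first by left.
    by right; exists i.+1.
- have -> : profile Q = nseq #|Q| (nseq (n - 1) 1 ++
      flatten [seq nseq (mult i) (p ^ i) | i <- iota 1 k]).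
    rewrite cardE -(size_map (fun b : Q => pattern (rtrans b))).
    apply/all_pred1P/allP => _ /mapP[b _ ->]; apply/eqP.
    (* Exponent 0 is included: it yields the leading block of ones. *)
    rewrite (pattern_ncycles _ _ [seq p ^ i | i <- iota 0 k.+1]).
    + rewrite /= expn0 nc1 -map_comp; congr (_ ++ flatten _).
      by apply/eq_in_map => i; rewrite mem_iota add1n ltnS => ik /=; rewrite ncm.
    + rewrite sorted_map; apply: sub_sorted (iota_ltn_sorted 0 k.+1) => i j /= ij.
      by rewrite ltn_exp2l.
    + move=> C /lenC[i ik ->]; by apply: map_f; rewrite mem_iota.
  by rewrite cardQ.
- move=> n2 /connected_alexander_unit.
  rewrite -unitrN opprB -(natrB _ n0) unitZpE // coprime_sym => co.
  (* Now [n - 1] is both coprime to [N] and a divisor of [N], so it equals 1, contradicting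
     [2 < n]. *)
  have := dvdn_expn_sub1 n 1 (p ^ k) (dvd1n _); rewrite expn1.
  by move=> /gcdn_idPl; rewrite (eqP co) => n1; rewrite -(subnK n0) -n1 in n2.
Qed.
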